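(* Let $\mathcal{K}=\{x_1,\ldots,x_L\}$ be a finite decoration set with $|\mathcal{K}|=L$, and let $s,k\in\mathbb{N}^+$. Suppose the $n\times n$ array of probability vectors $\theta=(\theta_{ij})$, $\theta_{ij}\in[0,1]^L$, $\|\theta_{ij}\|_1=1$, belongs to $\Theta_{s,k}$, and the one-hot encoded observations $X=(X_{ij})$ are generated as described in the context. Let $\widehat{\theta}\in\operatorname{argmin}_{\vartheta\in\Theta_{s,k}}\frac{1}{n^2}\|X-\vartheta\|_F^2$ be the least-squares estimator. Then for any $C'>0$ there exists $C>0$ such that $$\frac{1}{n^2}\sum_{i,j\in[n]}\big\|\widehat{\theta}_{ij}-\theta_{ij}\big\|_2^2\le C\Big(\frac{sL}{n^2}+\frac{\log(\max(k,s))}{n}\Big)$$ with probability at least $1-\exp(-C'n\log s)$, uniformly over $\theta\in\Theta_{s,k}$. Furthermore, $$\sup_{\theta\in\Theta_{s,k}}\mathbb{E}\Big[\frac{1}{n^2}\sum_{i,j}\|\widehat{\theta}_{ij}-\theta_{ij}\|_2^2\Big]\le C_1\Big(\frac{sL}{n^2}+\frac{\log(\max(k,s))}{n}\Big)$$ for some universal constant $C_1>0$, whenever $n>\max(0,k^2-s)$.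
   Context: Decorated graph model: a $\mathcal{K}$-decorated graph on $[n]$ has a symmetric adjacency array $A\in\mathcal{K}^{n\times n}$. Each $A_{ij}$ is encoded as a one-hot vector $X_{ij}\in\{0,1\}^L$ with $X_{ij}^{(l)}=1$ iff $A_{ij}=x_l$. Given the parameter array $\theta$ (the conditional distributions of the edges, $\theta_{ij}=W(\xi_i,\xi_j)$ for latent $\xi_i$), the vectors $X_{ij}$, $i<j$, are independent with $X_{ji}=X_{ij}$, and $\Pr(X_{ij}=e_l)=\theta_{ij}^{(l)}$ (so $\mathbb{E}X_{ij}=\theta_{ij}$). $\|\cdot\|_F$ denotes the Frobenius norm on $\mathbb{R}^{n\times n\times L}$. Stochastic shape model class: $\mathcal{Z}_{n,s,k}$ is the set of maps $z:[n]\times[n]\to[s]$ of the form $z(i,j)=u_s(u_k(i),u_k(j))$ where $u_k:[n]\to[k]$ is surjective and $u_s:[k]^2\to[s]$ is a symmetric surjective map (so each of the $s$ ''shapes'' is a symmetric union of blocks of a $k$-block partition). $\Theta_{s,k}$ is the set of $n\times n$ arrays $\vartheta$ with $\vartheta_{ij}=Q_{z(i,j)}$ (for $i\neq j$) for some $z\in\mathcal{Z}_{n,s,k}$ and some vectors $Q_1,\ldots,Q_s\in[0,1]^L$ that are probability vectors.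
   Formalization: The condition n > max(0, k²−s) is imposed on the high-probability bound too (it fails without it, e.g. k=n, s=L=2, θ≡(1/2,1/2)), and both the least-squares loss and the error sum run over i≠j only, since Θ_{s,k} leaves the diagonal unconstrained. *)

(* Defs.v *)
From HB Require Import structures.
From mathcomp Require Import all_boot all_order all_algebra.
From mathcomp Require Import reals sequences exp.

Set Implicit Arguments.
Unset Strict Implicit.
Unset Printing Implicit Defensive.

Import Order.TTheory GRing.Theory Num.Theory.
Local Open Scope ring_scope.

(* An n x n array of vectors indexed by the decoration set K (so L = #|K|).
   theta i j l = l-th coordinate of theta_{ij}. *)
Definition array (R : realType) (n : nat) (K : finType) := 'I_n -> 'I_n -> K -> R.

Definition prob_vec (R : realType) (K : finType) (q : K -> R) : Prop :=
  (forall l, 0 <= q l <= 1) /\ \sum_(l : K) q l = 1.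

Definition in_Z (n s k : nat) (z : 'I_n -> 'I_n -> 'I_s) : Prop :=
  exists (uk : 'I_n -> 'I_k) (us : 'I_k -> 'I_k -> 'I_s),
    (forall a : 'I_k, exists i : 'I_n, uk i = a) /\
    (forall a b : 'I_k, us a b = us b a) /\
    (forall c : 'I_s, exists a b : 'I_k, us a b = c) /\
    (forall i j, z i j = us (uk i) (uk j)).

Definition in_Theta (R : realType) (n s k : nat) (K : finType)
  (th : array R n K) : Prop :=
  exists (z : 'I_n -> 'I_n -> 'I_s) (Q : 'I_s -> K -> R),
    in_Z k z /\ (forall c, prob_vec (Q c)) /\
    (forall i j : 'I_n, i != j -> forall l, th i j l = Q (z i j) l).

Definition pairs (n : nat) := {p : 'I_n * 'I_n | (p.1 < p.2)%N}.
Definition Omega (n : nat) (K : finType) := {ffun pairs n -> K}.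

(* Probability mass of an outcome: the X_{ij}, i<j, are independent with
   Pr(A_{ij} = l) = theta_{ij}^{(l)}. *)
Definition weight (R : realType) (n : nat) (K : finType) (th : array R n K)
  (w : Omega n K) : R :=
  \prod_(p : pairs n) th (val p).1 (val p).2 (w p).

Definition Pr (R : realType) (n : nat) (K : finType) (th : array R n K)
  (E : pred (Omega n K)) : R :=
  \sum_(w : Omega n K | E w) weight th w.

Definition Exp (R : realType) (n : nat) (K : finType) (th : array R n K)
  (f : Omega n K -> R) : R :=
  \sum_(w : Omega n K) weight th w * f w.

(* decoration A_{ij} of the pair {i,j} (i <> j); None on the diagonal *)
Definition adj (n : nat) (K : finType) (w : Omega n K) (i j : 'I_n) : option K :=
  match @insub _ (fun p : 'I_n * 'I_n => (p.1 < p.2)%N) (pairs n) (i, j) with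
  | Some p => Some (w p)
  | None =>
    match @insub _ (fun p : 'I_n * 'I_n => (p.1 < p.2)%N) (pairs n) (j, i) with
    | Some p => Some (w p)
    | None => None
    end
  end.

(* one-hot encoding X_{ij}^{(l)} = 1 iff A_{ij} = x_l (zero vector on the
   diagonal, which is never used) *)
Definition X (R : realType) (n : nat) (K : finType) (w : Omega n K) : array R n K :=
  fun i j l => if adj w i j is Some a then (a == l)%:R else 0.

Definition sqdist (R : realType) (n : nat) (K : finType) (a b : array R n K) : R :=
  \sum_(i : 'I_n) \sum_(j : 'I_n | i != j) \sum_(l : K) (a i j l - b i j l) ^+ 2.

Definition risk (R : realType) (n : nat) (K : finType) (a b : array R n K) : R :=
  (n%:R ^+ 2)^-1 * sqdist a b.

Definition is_LSE (R : realType) (n s k : nat) (K : finType)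
  (est : Omega n K -> array R n K) : Prop :=
  forall w, in_Theta s k (est w) /\
    forall th, in_Theta s k th -> risk (X R w) (est w) <= risk (X R w) th.

Definition rate (R : realType) (n s k L : nat) : R :=
  (s * L)%:R / n%:R ^+ 2 + ln (maxn k s)%:R / n%:R.

(* Main.v *)
Require Import Defs.
From HB Require Import structures.
From mathcomp Require Import all_boot all_order all_algebra.
From mathcomp Require Import reals sequences exp.
From mathcomp Require Import ring lra zify.

Set Implicit Arguments.
Unset Strict Implicit.
Unset Printing Implicit Defensive.

Import Order.TTheory GRing.Theory Num.Theory.
Local Open Scope ring_scope.

(* For a fixed shape z, write e = X - theta and let m be the array of block
   means of theta. The basic inequality |est - theta|^2 <= 2 <est - theta, e>,
   split along the orthogonal sum (est - m) + (m - theta), bounds the squared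
   error by a multiple of the energy of the block averages of e plus the squared
   component of e along the deterministic direction m - theta. Both are weighted
   sums of squared norms of sums S of independent centred vectors; integrating
   the coordinates out one at a time with e^x <= x + e^(2 x^2) shows that
   E exp (c |S|^2 / variance) <= exp c' for each of them. A union bound over the
   at most k^n s^(k^2) shapes then gives
     E exp (c |est - theta|^2) <= exp (n log k + k^2 log s + O(s)),
   where k^2 <= 3 n, and both claims follow from this exponential moment. *)

(** * Elementary inequalities and the one-coordinate moment step *)

(** The linear term averages to zero for a centred variable, leaving only a quadratic exponent.
    Above 1/2 already x <= 2 x^2; up to 1/2, e^x <= 1 / (1 - x) <= 1 + x + 2 x^2. *)
Lemma expR_le_id_add_expR_sqr (R : realType) (x : R) :
  expR x <= x + expR (2 * x ^+ 2).
Proof.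
have [hx|hx] := leP x (2^-1); last first.
  apply: (@le_trans _ _ (expR (2 * x ^+ 2))); last by lra.
  by rewrite ler_expR; nra.
apply: (@le_trans _ _ (x + (1 + 2 * x ^+ 2))); last first.
  by rewrite lerD2l expR_ge1Dx.
have h1 : (1 - x) * expR x <= 1.
  have /(ler_wpM2r (expR_ge0 x)) := expR_ge1Dx (- x).
  by rewrite expRN mulVf ?expR_eq0.
rewrite -(ler_pM2l (x := 1 - x)); last by lra.
apply: (le_trans h1).
suff : 0 <= x ^+ 2 * (1 - 2 * x) by lra.
by rewrite mulr_ge0 ?sqr_ge0 //; lra.
Qed.

Lemma cauchy_schwarz_sum (R : realType) (J : finType) (x y : J -> R) :
  (\sum_j x j * y j) ^+ 2 <= (\sum_j x j ^+ 2) * (\sum_j y j ^+ 2).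
Proof.
have : 0 <= \sum_i \sum_j (x i * y j - x j * y i) ^+ 2.
  by apply: sumr_ge0 => i _; apply: sumr_ge0 => j _; exact: sqr_ge0.
have -> : \sum_i \sum_j (x i * y j - x j * y i) ^+ 2 =
    \sum_i \sum_j (x i ^+ 2 * y j ^+ 2) + \sum_i \sum_j (y i ^+ 2 * x j ^+ 2)
    - 2 * \sum_i \sum_j ((x i * y i) * (x j * y j)).
  rewrite mulr_sumr -big_split -sumrB; apply: eq_bigr => i _ /=.
  rewrite mulr_sumr -big_split -sumrB; apply: eq_bigr => j _ /=; ring.
rewrite -!big_distrlr /= expr2; lra.
Qed.

(** A crude bound through the maximum of x and y. It separates the two noise energies, which are
    dependent, at the price of halving the exponent. *)
Lemma expR_half_add_le (R : realType) (x y : R) :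
  expR ((x + y) / 2) <= expR x + expR y.
Proof.
have [xy|yx] := leP x y.
  apply: (@le_trans _ _ (expR y)); first by rewrite ler_expR; lra.
  by rewrite lerDr expR_ge0.
apply: (@le_trans _ _ (expR x)); first by rewrite ler_expR; lra.
by rewrite lerDl expR_ge0.
Qed.

(** Expand |Y + S|^2. The cross term is centred, so [expR_le_id_add_expR_sqr] trades it for its
    square, which Cauchy-Schwarz bounds by a multiple of r |S|^2. Enlarging the denominator by 8 r
    absorbs that excess. *)
Lemma expR_sqnorm_step (R : realType) (K J : finType) (q : K -> R)
    (Y : K -> J -> R) (S : J -> R) (r beta : R) :
  (forall l, 0 <= q l) -> \sum_l q l = 1 ->
  (forall j, \sum_l q l * Y l j = 0) ->
  0 <= r -> 0 < beta -> (forall l, \sum_j Y l j ^+ 2 <= r) ->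
  \sum_l q l * expR ((\sum_j (Y l j + S j) ^+ 2) / (beta + 8 * r)) <=
  expR (r / beta + (\sum_j S j ^+ 2) / beta).
Proof.
move=> q0 q1 qY r0 beta0 Yr.
set N := \sum_j S j ^+ 2.
have N0 : 0 <= N by apply: sumr_ge0 => j _; exact: sqr_ge0.
set a := (beta + 8 * r)^-1.
have br0 : 0 < beta + 8 * r by lra.
have a0 : 0 < a by rewrite invr_gt0.
pose t l := 2 * a * \sum_j Y l j * S j.
have EsplitL l : (\sum_j (Y l j + S j) ^+ 2) / (beta + 8 * r) <=
    (a * N + a * r) + t l.
  have -> : \sum_j (Y l j + S j) ^+ 2 =
      \sum_j Y l j ^+ 2 + N + 2 * \sum_j Y l j * S j.
    rewrite mulr_sumr -!big_split; apply: eq_bigr => j _ /=; ring.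
  rewrite -/a /t [_ * a]mulrC !mulrDr addrAC [a * N + _]addrC.
  have := ler_wpM2l (ltW a0) (Yr l); lra.
have tsq l : 2 * t l ^+ 2 <= 8 * a ^+ 2 * (r * N).
  have h : (\sum_j Y l j * S j) ^+ 2 <= r * N.
    apply: (le_trans (cauchy_schwarz_sum _ _)).
    by apply: ler_wpM2r => //; exact: Yr.
  have := ler_wpM2l (sqr_ge0 a) h; rewrite /t !exprMn; lra.
apply: (@le_trans _ _ (expR (a * N + a * r) * expR (8 * a ^+ 2 * (r * N)))).
  apply: (@le_trans _ _ (\sum_l expR (a * N + a * r) *
      (q l * t l + q l * expR (8 * a ^+ 2 * (r * N))))).
    apply: ler_sum => l _; rewrite -[q l * t l + _]mulrDr [leRHS]mulrCA.
    apply: ler_wpM2l => //.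
    apply: (@le_trans _ _ (expR ((a * N + a * r) + t l))).
      by rewrite ler_expR.
    rewrite expRD; apply: ler_wpM2l; first exact: expR_ge0.
    apply: (le_trans (expR_le_id_add_expR_sqr _)).
    by rewrite lerD2l ler_expR.
  rewrite -mulr_sumr big_split /= -mulr_suml q1 mul1r.
  have -> : \sum_l q l * t l = 0.
    rewrite (eq_bigr (fun l => 2 * a * \sum_j S j * (q l * Y l j))); last first.
      move=> l _; rewrite /t mulrCA mulr_sumr; congr (_ * _).
      by apply: eq_bigr => j _; ring.
    rewrite -mulr_sumr exchange_big /= big1 ?mulr0 // => j _.
    by rewrite -mulr_sumr qY mulr0.
  by rewrite add0r.
rewrite -expRD ler_expR.
have arb : a <= beta^-1 by rewrite lef_pV2 ?posrE //; lra.
(* After clearing denominators this is beta (beta + 16 r) <= (beta + 8 r)^2. The terms linear in r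
   match exactly, which fixes the constant 8. *)
have key : a + 8 * a ^+ 2 * r <= beta^-1.
  rewrite -[_ + _](mulKf (lt0r_neq0 beta0)) ger_pMr ?invr_gt0 //.
  rewrite -[leLHS](mulfK (x := (beta + 8 * r) ^+ 2)); last first.
    by rewrite expf_neq0 // gt_eqF.
  rewrite ler_pdivrMr ?exprn_gt0 // mul1r.
  have -> : beta * (a + 8 * a ^+ 2 * r) * (beta + 8 * r) ^+ 2 =
     beta * (beta + 16 * r).
    by rewrite /a; field; rewrite gt_eqF.
  nra.
have := ler_wpM2r N0 key; have := ler_wpM2r r0 arb.
lra.
Qed.

(** * Exponential moments under a finite product measure *)

Section ProductExpectation.
Context (R : realType) (P K : finType) (q : P -> K -> R).

Definition prodE (f : {ffun P -> K} -> R) : R :=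
  \sum_(w : {ffun P -> K}) (\prod_p q p (w p)) * f w.

Definition update (w : {ffun P -> K}) (p : P) (l : K) : {ffun P -> K} :=
  [ffun p' => if p' == p then l else w p'].

Hypothesis q_ge0 : forall p l, 0 <= q p l.
Hypothesis q_sum1 : forall p, \sum_l q p l = 1.

Lemma prodE_le (f g : {ffun P -> K} -> R) :
  (forall w, f w <= g w) -> prodE f <= prodE g.
Proof.
move=> fg; apply: ler_sum => w _; apply: ler_wpM2l => //.
by apply: prodr_ge0.
Qed.

Lemma prodE_mulr (f : {ffun P -> K} -> R) (a : R) :
  prodE (fun w => a * f w) = a * prodE f.
Proof. by rewrite mulr_sumr; apply: eq_bigr => w _; rewrite mulrCA. Qed.

Lemma prodE_add (f g : {ffun P -> K} -> R) :
  prodE (fun w => f w + g w) = prodE f + prodE g.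
Proof. by rewrite -big_split; apply: eq_bigr => w _; rewrite mulrDr. Qed.

Lemma prodE_sum (T : finType) (f : T -> {ffun P -> K} -> R) :
  prodE (fun w => \sum_t f t w) = \sum_t prodE (f t).
Proof. by rewrite exchange_big; apply: eq_bigr => w _; rewrite mulr_sumr. Qed.

Lemma prodE_cst (a : R) : prodE (fun=> a) = a.
Proof.
rewrite /prodE -mulr_suml -(bigA_distr_bigA (fun p l => q p l)) big1 ?mul1r //.
Qed.

(* The involution (w, l) |-> (w[p := l], w p) preserves the product of the
   weights of w and l. *)
Lemma prodE_resample (p : P) (f : {ffun P -> K} -> R) :
  prodE f = prodE (fun w => \sum_l q p l * f (update w p l)).
Proof.
pose swap (x : {ffun P -> K} * K) := (update x.1 p x.2, x.1 p).
have swapK : involutive swap.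
  case=> w l; congr (_, _); last by rewrite /= ffunE eqxx.
  by apply/ffunP => p'; rewrite !ffunE /=; case: eqP => [->|].
rewrite /prodE.
under [RHS]eq_bigr do rewrite mulr_sumr.
rewrite pair_bigA /= (reindex_inj (inv_inj swapK)) /=.
transitivity (\sum_(x : {ffun P -> K} * K)
    (\prod_p' q p' (x.1 p')) * f x.1 * q p x.2).
  rewrite -(pair_bigA _ (fun (w : {ffun P -> K}) l =>
    (\prod_p' q p' (w p')) * f w * q p l)) /=.
  by apply: eq_bigr => w _; rewrite -mulr_sumr q_sum1 mulr1.
apply: eq_bigr => -[w l] _ /=.
have -> : update (update w p l) p (w p) = w.
  by apply/ffunP => p'; rewrite !ffunE /=; case: eqP => [->|].
rewrite (bigD1 p) //= [in RHS](bigD1 p) //= ffunE eqxx.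
rewrite [in RHS](eq_bigr (fun p' => q p' (w p'))); first by ring.
by move=> p' /negbTE np; rewrite ffunE np.
Qed.

(** Induction on [D]. Integrating out the head p touches only the block sum of [g p], and
    [expR_sqnorm_step] applies with beta the denominator accumulated over the tail. Each step costs
    at most [r p / b (g p)], since denominators only grow. *)
Lemma prodE_expR_sqnorm_seq (G J : finType) (g : P -> G)
    (Y : P -> K -> J -> R) (r : P -> R) (b : G -> R) (D : seq P) :
  (forall p j, \sum_l q p l * Y p l j = 0) ->
  (forall p, 0 <= r p) -> (forall h, 0 < b h) ->
  (forall p l, \sum_j Y p l j ^+ 2 <= r p) -> uniq D ->
  prodE (fun w => expR (\sum_h
    (\sum_j (\sum_(p <- D | g p == h) Y p (w p) j) ^+ 2) /
      (b h + 8 * \sum_(p <- D | g p == h) r p))) <=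
  expR (\sum_(p <- D) r p / b (g p)).
Proof.
move=> qY r0 b0 Yr; elim: D => [|p D IH] /=.
  move=> _; rewrite big_nil expR0 -[leRHS](prodE_cst 1); apply: prodE_le => w.
  rewrite big1 ?expR0 // => h _; rewrite big1 ?mul0r // => j _.
  by rewrite big_nil expr0n.
case/andP=> pD uD; rewrite (prodE_resample p) big_cons expRD.
apply: (@le_trans _ _ (prodE (fun w => expR (r p / b (g p)) * expR (\sum_h
    (\sum_j (\sum_(p <- D | g p == h) Y p (w p) j) ^+ 2) /
      (b h + 8 * \sum_(p <- D | g p == h) r p))))); last first.
  by rewrite prodE_mulr; apply: ler_wpM2l; [exact: expR_ge0|exact: IH].
apply: prodE_le => w.
pose S h j := \sum_(p' <- D | g p' == h) Y p' (w p') j.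
pose B h := b h + 8 * \sum_(p' <- D | g p' == h) r p'.
have B_ge h : b h <= B h.
  by rewrite lerDl mulr_ge0 // sumr_ge0.
(* As p does not occur in the tail [D], resampling it leaves the tail sums unchanged. *)
have updD l h j : \sum_(p' <- D | g p' == h) Y p' (update w p l p') j = S h j.
  rewrite /S big_seq_cond [RHS]big_seq_cond; apply: eq_bigr => p' /andP[p'D _].
  rewrite ffunE; case: eqP => // e; by rewrite e (negbTE pD) in p'D.
pose rest := \sum_(h | h != g p) (\sum_j S h j ^+ 2) / B h.
rewrite (eq_bigr (fun l => expR rest * (q p l * expR
    ((\sum_j (Y p l j + S (g p) j) ^+ 2) / (B (g p) + 8 * r p))))); last first.
  move=> l _; rewrite mulrCA; congr (_ * _); rewrite -expRD; congr expR.
  rewrite (bigD1 (g p)) //= addrC; congr (_ + _).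
    apply: eq_bigr => h /negbTE hp; rewrite eq_sym in hp.
    congr (_ / _); last by rewrite big_cons hp.
    by apply: eq_bigr => j _; rewrite big_cons hp updD.
  congr (_ / _); last by rewrite big_cons eqxx /B; ring.
  by apply: eq_bigr => j _; rewrite big_cons eqxx updD ffunE eqxx.
have -> : \sum_h (\sum_j (\sum_(p' <- D | g p' == h) Y p' (w p') j) ^+ 2) /
      (b h + 8 * \sum_(p' <- D | g p' == h) r p') =
    (\sum_j S (g p) j ^+ 2) / B (g p) + rest by rewrite (bigD1 (g p)).
rewrite -mulr_sumr.
have Bp0 := lt_le_trans (b0 (g p)) (B_ge (g p)).
apply: (@le_trans _ _ (expR rest * expR (r p / B (g p) +
    (\sum_j S (g p) j ^+ 2) / B (g p)))).
  apply: ler_wpM2l; first exact: expR_ge0.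
  by apply: expR_sqnorm_step => //.
rewrite -!expRD ler_expR.
have : r p / B (g p) <= r p / b (g p).
  by apply: ler_wpM2l => //; rewrite lef_pV2 ?posrE.
lra.
Qed.

Lemma prodE_expR_sqnorm (G J : finType) (g : P -> G)
    (Y : P -> K -> J -> R) (r : P -> R) (b : G -> R) :
  (forall p j, \sum_l q p l * Y p l j = 0) ->
  (forall p, 0 <= r p) -> (forall h, 0 < b h) ->
  (forall p l, \sum_j Y p l j ^+ 2 <= r p) ->
  prodE (fun w => expR (\sum_h
    (\sum_j (\sum_(p | g p == h) Y p (w p) j) ^+ 2) /
      (b h + 8 * \sum_(p | g p == h) r p))) <=
  expR (\sum_p r p / b (g p)).
Proof.
move=> qY r0 b0 Yr.
exact: prodE_expR_sqnorm_seq qY r0 b0 Yr (index_enum_uniq P).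
Qed.

End ProductExpectation.

(** * The deterministic least-squares inequality *)

Section LeastSquares.
Context (R : realType) (P K G : finType).

Definition block_size (g : P -> G) (h : G) : R := #|[pred p | g p == h]|%:R.

Definition block_mean (g : P -> G) (q : P -> K -> R) (h : G) (l : K) : R :=
  (\sum_(p | g p == h) q p l) / block_size g h.

Definition bias (g : P -> G) (q : P -> K -> R) (p : P) (l : K) : R :=
  block_mean g q (g p) l - q p l.

(** The squared norm of the orthogonal projection of e onto the block-constant arrays. Empty blocks
    contribute 0, since division by 0 yields 0. *)
Definition block_energy (g : P -> G) (e : P -> K -> R) : R :=
  \sum_h (\sum_l (\sum_(p | g p == h) e p l) ^+ 2) / block_size g h.

(** The squared norm of the projection of e onto the line spanned by u, and 0 when u vanishes. *)
Definition direction_energy (u e : P -> K -> R) : R :=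
  (\sum_p \sum_l u p l * e p l) ^+ 2 / \sum_p \sum_l u p l ^+ 2.

Lemma block_size_ge0 (g : P -> G) h : 0 <= block_size g h.
Proof. exact: ler0n. Qed.

Lemma block_size_eq0 (g : P -> G) h p :
  block_size g h = 0 -> (g p == h) = false.
Proof.
by move/eqP; rewrite pnatr_eq0 => /eqP/card0_eq/(_ p); rewrite inE.
Qed.

Lemma block_sum_cst (g : P -> G) h (x : R) :
  \sum_(p | g p == h) x = block_size g h * x.
Proof. by rewrite sumr_const -mulr_natl. Qed.

Lemma sum_block_cst_mul (g : P -> G) (C : G -> K -> R) (e : P -> K -> R) :
  \sum_p \sum_l C (g p) l * e p l =
  \sum_h \sum_l C h l * \sum_(p | g p == h) e p l.
Proof.
rewrite (partition_big g xpredT) //=; apply: eq_bigr => h _.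
rewrite exchange_big /=; apply: eq_bigr => l _.
by rewrite mulr_sumr; apply: eq_bigr => p /eqP->.
Qed.

Lemma block_energy_ge0 g e : 0 <= block_energy g e.
Proof.
apply: sumr_ge0 => h _; apply: divr_ge0; last exact: block_size_ge0.
by apply: sumr_ge0 => l _; exact: sqr_ge0.
Qed.

Lemma direction_energy_ge0 u e : 0 <= direction_energy u e.
Proof.
apply: divr_ge0; first exact: sqr_ge0.
by apply: sumr_ge0 => p _; apply: sumr_ge0 => l _; exact: sqr_ge0.
Qed.

(** This is the orthogonality of the bias to every block-constant array, which makes the squared
    error split by Pythagoras. *)
Lemma block_sum_bias (g : P -> G) (q : P -> K -> R) h l :
  \sum_(p | g p == h) bias g q p l = 0.
Proof.
rewrite (eq_bigr (fun p => block_mean g q h l - q p l)); last first.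
  by move=> p /eqP gp; rewrite /bias gp.
rewrite big_split /= block_sum_cst sumrN /block_mean.
have [N0|N0] := eqVneq (block_size g h) 0; last first.
  by rewrite mulrC divfK // subrr.
by rewrite N0 mul0r add0r big1 ?oppr0 // => p; rewrite block_size_eq0.
Qed.

(** Young's inequality. The weight 1/4 is small enough for the quadratic terms to be moved to the
    left of the basic inequality. *)
Lemma weighted_two_mul_le (x y N : R) : 0 < N ->
  2 * (x * y) <= 4^-1 * (N * x ^+ 2) + 4 * (y ^+ 2 / N).
Proof.
move=> N0; set v := y / N.
have -> : y = v * N by rewrite /v divfK ?gt_eqF.
have -> : (v * N) ^+ 2 / N = v ^+ 2 * N by field; rewrite gt_eqF.
have := mulr_ge0 (ltW N0) (sqr_ge0 (2^-1 * x - 2 * v)).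
lra.
Qed.

Lemma two_dot_block_le (g : P -> G) (C : G -> K -> R) (e : P -> K -> R) :
  2 * \sum_p \sum_l C (g p) l * e p l <=
  4^-1 * (\sum_p \sum_l C (g p) l ^+ 2) + 4 * block_energy g e.
Proof.
rewrite [X in 4^-1 * X](eq_bigr (fun p => \sum_l C (g p) l * C (g p) l));
  last first.
  by move=> p _; apply: eq_bigr => l _; rewrite expr2.
rewrite (sum_block_cst_mul g C e) (sum_block_cst_mul g C (fun p => C (g p))).
rewrite /block_energy !mulr_sumr -big_split; apply: ler_sum => h _ /=.
rewrite mulr_suml !mulr_sumr -big_split; apply: ler_sum => l _ /=.
have -> : \sum_(p | g p == h) C (g p) l = block_size g h * C h l.
  by rewrite -block_sum_cst; apply: eq_bigr => p /eqP->.
have [N0|N0] := eqVneq (block_size g h) 0.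
  have -> : \sum_(p | g p == h) e p l = 0.
    by rewrite big1 // => p; rewrite block_size_eq0.
  by rewrite N0 !mulr0 mul0r !mulr0 expr0n /= mul0r mulr0 addr0.
have Npos : 0 < block_size g h by rewrite lt0r N0 block_size_ge0.
by have := weighted_two_mul_le (C h l) (\sum_(p | g p == h) e p l) Npos; lra.
Qed.

Lemma two_dot_direction_le (u e : P -> K -> R) :
  2 * \sum_p \sum_l u p l * e p l <=
  4^-1 * (\sum_p \sum_l u p l ^+ 2) + 4 * direction_energy u e.
Proof.
rewrite /direction_energy.
set U := \sum_p \sum_l u p l ^+ 2; set T := \sum_p \sum_l u p l * e p l.
have U_ge0 : 0 <= U.
  by apply: sumr_ge0 => p _; apply: sumr_ge0 => l _; exact: sqr_ge0.
(* When U = 0 the quotient is 0 by convention, so the inner product itself must vanish. *)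
have [U0|U0] := eqVneq U 0.
  have T0 : T ^+ 2 <= 0.
    have := cauchy_schwarz_sum (fun x : P * K => u x.1 x.2)
      (fun x => e x.1 x.2).
    rewrite -(pair_bigA _ (fun p l => u p l * e p l)) /=.
    rewrite -(pair_bigA _ (fun p l => u p l ^+ 2)) /=.
    by rewrite -/U U0 mul0r.
  have -> : T = 0 by apply/eqP; rewrite -sqrf_eq0 eq_le T0 sqr_ge0.
  by rewrite U0 expr0n /= mul0r !mulr0 addr0.
have Upos : 0 < U by rewrite lt0r U0.
by have := weighted_two_mul_le 1 T Upos; lra.
Qed.

(* A block-constant minimizer t is compared to q through the block means of q:
   t - mean and mean - q are orthogonal, the first is block-constant and the
   second does not depend on the data x. *)
Lemma least_squares_error_le (g : P -> G) (q x t : P -> K -> R)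
    (Q : G -> K -> R) :
  (forall p l, t p l = Q (g p) l) ->
  \sum_p \sum_l (x p l - t p l) ^+ 2 <= \sum_p \sum_l (x p l - q p l) ^+ 2 ->
  \sum_p \sum_l (t p l - q p l) ^+ 2 <=
  6 * (block_energy g (fun p l => x p l - q p l) +
       direction_energy (bias g q) (fun p l => x p l - q p l)).
Proof.
move=> tQ; pose e p l := x p l - q p l; pose u := bias g q.
pose C h l := Q h l - block_mean g q h l.
have tE p l : t p l = q p l + (C (g p) l + u p l).
  by rewrite tQ /C /u /bias; ring.
have -> : \sum_p \sum_l (x p l - t p l) ^+ 2 =
    \sum_p \sum_l (x p l - q p l) ^+ 2 + \sum_p \sum_l (t p l - q p l) ^+ 2 -
    2 * \sum_p \sum_l C (g p) l * e p l - 2 * \sum_p \sum_l u p l * e p l.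
  rewrite !mulr_sumr -big_split -!sumrB; apply: eq_bigr => p _ /=.
  rewrite !mulr_sumr -big_split -!sumrB; apply: eq_bigr => l _ /=.
  by rewrite tE /e; ring.
have -> : \sum_p \sum_l (t p l - q p l) ^+ 2 =
    \sum_p \sum_l C (g p) l ^+ 2 + \sum_p \sum_l u p l ^+ 2.
  transitivity (\sum_p \sum_l C (g p) l ^+ 2 + \sum_p \sum_l u p l ^+ 2 +
      2 * \sum_p \sum_l C (g p) l * u p l).
    rewrite mulr_sumr -!big_split; apply: eq_bigr => p _ /=.
    rewrite mulr_sumr -!big_split; apply: eq_bigr => l _ /=.
    by rewrite tE; ring.
  rewrite sum_block_cst_mul [X in 2 * X]big1 ?mulr0 ?addr0 // => h _.
  by rewrite big1 // => l _; rewrite block_sum_bias mulr0.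
(* With D the squared error, D <= D / 4 + 4 (sum of the energies). Hence D is at most 16/3 of that
   sum, rounded up to 6. *)
have := two_dot_block_le g C e; have := two_dot_direction_le u e.
have := block_energy_ge0 g e; have := direction_energy_ge0 u e.
rewrite -/e -/u; lra.
Qed.

End LeastSquares.

(** * Exponential moments of the noise energies and the union bound over shapes *)

Section LeastSquaresMoment.
Context (R : realType) (P K G : finType) (q : P -> K -> R).
Hypothesis q_ge0 : forall p l, 0 <= q p l.
Hypothesis q_sum1 : forall p, \sum_l q p l = 1.

Definition noise (w : {ffun P -> K}) (p : P) (l : K) : R :=
  (w p == l)%:R - q p l.

Lemma sum_indicator_mul (f : K -> R) (a : K) : \sum_l f l * (l == a)%:R = f a.
Proof.
rewrite (bigD1 a) //= eqxx mulr1 big1 ?addr0 // => l /negbTE->.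
by rewrite mulr0.
Qed.

Lemma noise_mean0 p j : \sum_l q p l * ((l == j)%:R - q p j) = 0.
Proof.
under eq_bigr do rewrite mulrBr.
by rewrite sumrB sum_indicator_mul -mulr_suml q_sum1 mul1r subrr.
Qed.

(** Indicator and probability both lie in [0, 1], so the squared difference is at most their sum,
    and each sums to 1. The bound is free of the number of decorations. *)
Lemma noise_sqnorm_le2 p a : \sum_l ((a == l)%:R - q p l) ^+ 2 <= 2.
Proof.
apply: (@le_trans _ _ (\sum_l ((1 * (l == a)%:R) + q p l))).
  apply: ler_sum => l _; rewrite [a == l]eq_sym.
  have q1 : q p l <= 1.
    by rewrite -(q_sum1 p) (bigD1 l) //= lerDl sumr_ge0.
  have := mulr_ge0 (q_ge0 p l) (q_ge0 p l).
  have : 0 <= q p l * (1 - q p l) by rewrite mulr_ge0 ?subr_ge0.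
  have := q_ge0 p l; case: eqP => _ /=; lra.
rewrite big_split /= q_sum1 (sum_indicator_mul (fun=> 1)); lra.
Qed.

Lemma prodE_block_energy (g : P -> G) :
  prodE q (fun w => expR (block_energy g (noise w) / 33)) <=
  expR (#|G|%:R / 8).
Proof.
(* With r = 2 and N the block size, the final denominator is 32 N + 1 <= 33 N on nonempty blocks,
   and each block costs 2 N / (16 N + 1) <= 1/8. The added 1 keeps [b h] positive on empty
   blocks. *)
pose b h : R := 16 * block_size R g h + 1.
have N0 h : 0 <= block_size R g h := block_size_ge0 R g h.
have b0 h : 0 < b h by rewrite /b; have := N0 h; lra.
apply: (@le_trans _ _ (expR (\sum_p 2 / b (g p)))); last first.
  rewrite ler_expR (partition_big g xpredT) //=.
  apply: (@le_trans _ _ (\sum_(h : G) 8^-1)); last first.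
    by rewrite sumr_const -[leLHS]mulr_natl.
  apply: ler_sum => h _.
  rewrite (eq_bigr (fun=> 2 / b h)); last by move=> p /eqP->.
  rewrite block_sum_cst mulrA ler_pdivrMr //.
  rewrite /b; lra.
apply: le_trans (prodE_expR_sqnorm q_ge0 q_sum1 g (J := K)
  (Y := fun p a l => (a == l)%:R - q p l) (r := fun=> 2) _ _ b0 _).
- apply: prodE_le => // w; rewrite ler_expR /block_energy mulr_suml.
  apply: ler_sum => h _; rewrite -mulrA.
  have [Nz|Nz] := eqVneq (block_size R g h) 0.
    rewrite Nz invr0 mul0r mulr0; apply: divr_ge0.
      by apply: sumr_ge0 => l _; exact: sqr_ge0.
    by apply: addr_ge0; [exact: ltW|rewrite mulr_ge0 // sumr_ge0].
  have N1 : 1 <= block_size R g h.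
    by move: Nz; rewrite /block_size pnatr_eq0 -lt0n ler1n.
  apply: ler_wpM2l; first by apply: sumr_ge0 => l _; exact: sqr_ge0.
  rewrite block_sum_cst -invfM lef_pV2 ?posrE.
  + by rewrite /b; lra.
  + lra.
  + by rewrite /b; lra.
- exact: noise_mean0.
- by [].
- exact: noise_sqnorm_le2.
Qed.

(** A single block with the scalar summands <u_p, e_p>, whose squares are at most 2 |u_p|^2. The
    choice b = 16 U gives the denominator 32 U and the total cost 2 U / (16 U) = 1/8. *)
Lemma prodE_direction_energy (u : P -> K -> R) :
  prodE q (fun w => expR (direction_energy u (noise w) / 32)) <= expR 8^-1.
Proof.
set U := \sum_p \sum_l u p l ^+ 2.
have up0 p : 0 <= \sum_l u p l ^+ 2 by apply: sumr_ge0 => l _; exact: sqr_ge0.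
have U0 : 0 <= U by exact: sumr_ge0.
have [Uz|Unz] := eqVneq U 0.
  rewrite -[leRHS](prodE_cst q_sum1); apply: prodE_le => // w.
  by rewrite ler_expR /direction_energy -/U Uz invr0 mulr0 mul0r invr_ge0.
have Upos : 0 < U by rewrite lt0r Unz.
apply: (@le_trans _ _ (expR (\sum_p (2 * \sum_l u p l ^+ 2) / (16 * U))));
  last first.
  rewrite -mulr_suml -mulr_sumr -/U ler_expR.
  by rewrite le_eqVlt; apply/orP; left; apply/eqP; field.
apply: le_trans (prodE_expR_sqnorm q_ge0 q_sum1
  (G := unit) (fun=> tt) (J := unit)
  (Y := fun p a _ => \sum_l u p l * ((a == l)%:R - q p l))
  (r := fun p => 2 * \sum_l u p l ^+ 2) (b := fun=> 16 * U) _ _ _ _).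
- apply: prodE_le => // w; rewrite ler_expR /direction_energy.
  rewrite !(big_pred1 tt); try by case.
  rewrite -mulr_sumr -!/U.
  rewrite le_eqVlt; apply/orP; left; apply/eqP.
  rewrite -mulrA -invfM; congr (_ / _); ring.
- move=> p _; under eq_bigr do rewrite mulr_sumr.
  rewrite exchange_big /= big1 // => j _.
  under eq_bigr do rewrite mulrCA.
  by rewrite -mulr_sumr noise_mean0 mulr0.
- by move=> p; rewrite mulr_ge0.
- by move=> _; rewrite mulr_gt0.
- move=> p a; rewrite (big_pred1 tt); last by case.
  apply: (le_trans (cauchy_schwarz_sum _ _)); rewrite mulrC.
  by apply: ler_wpM2r => //; exact: noise_sqnorm_le2.
Qed.

(** The shape selected by [est] depends on the outcome, so its term is bounded by the sum over all
    shapes, each of which is deterministic. *)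
Lemma least_squares_exp_moment (T : finType) (g : T -> P -> G)
    (est : {ffun P -> K} -> P -> K -> R) :
  (0 < #|G|)%N ->
  (forall w, exists t (Q : G -> K -> R), forall p l, est w p l = Q (g t p) l) ->
  (forall w : {ffun P -> K}, \sum_p \sum_l ((w p == l)%:R - est w p l) ^+ 2 <=
             \sum_p \sum_l (noise w p l) ^+ 2) ->
  prodE q (fun w => expR ((\sum_p \sum_l (est w p l - q p l) ^+ 2) / 396)) <=
  #|T|%:R * (2 * expR (#|G|%:R / 8)).
Proof.
move=> G0 est_block est_min.
apply: (@le_trans _ _ (prodE q (fun w => \sum_t
   (expR (block_energy (g t) (noise w) / 33) +
    expR (direction_energy (bias (g t) q) (noise w) / 32))))); last first.
  rewrite prodE_sum mulr_natl -sumr_const; apply: ler_sum => t _.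
  rewrite prodE_add mulr_natl mulr2n; apply: lerD.
    exact: prodE_block_energy.
  apply: (le_trans (prodE_direction_energy _)); rewrite ler_expR.
  by rewrite -[leLHS]mul1r ler_pM2r ?invr_gt0 // ler1n.
apply: prodE_le => // w; have [t [Q estQ]] := est_block w.
have := least_squares_error_le estQ (est_min w).
rewrite -[fun p l => _ - _]/(noise w) => le6.
rewrite (bigD1 t) //=; apply: ler_wpDr.
  by apply: sumr_ge0 => t' _; rewrite addr_ge0 ?expR_ge0.
(* 396 = 2 * 6 * 33: the halved exponent, the least-squares constant and the block-energy scale. The
   direction scale 32 is smaller than 33, hence the sign needed below. *)
apply: le_trans (expR_half_add_le _ _); rewrite ler_expR.
have := direction_energy_ge0 (bias (g t) q) (noise w); lra.
Qed.

End LeastSquaresMoment.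

(** * From symmetric arrays to pairs i < j, and the size of k *)

Lemma sum_pairsE (R : realType) (n : nat) (f : 'I_n -> 'I_n -> R) :
  \sum_(x : 'I_n * 'I_n | (x.1 < x.2)%N) f x.1 x.2 =
  \sum_(p : pairs n) f (val p).1 (val p).2.
Proof.
rewrite (reindex_omap (val : pairs n -> _) insub) /=; last first.
  by move=> x hx; rewrite insubT.
by apply: eq_bigl => p; rewrite valK eqxx andbT; case: p.
Qed.

Lemma sum_offdiag_sym (R : realType) (n : nat) (f : 'I_n -> 'I_n -> R) :
  (forall i j, i != j -> f i j = f j i) ->
  \sum_(i : 'I_n) \sum_(j : 'I_n | i != j) f i j =
  2 * \sum_(p : pairs n) f (val p).1 (val p).2.
Proof.
move=> fC; rewrite pair_big_dep /=.
rewrite (bigID (fun x : 'I_n * 'I_n => (x.1 < x.2)%N)) /=.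
rewrite -sum_pairsE mulr_natl mulr2n; congr (_ + _).
  by apply: eq_bigl => x; rewrite -val_eqE; case: ltngtP.
pose sw (x : 'I_n * 'I_n) := (x.2, x.1).
have swK : involutive sw by case.
rewrite (reindex_inj (inv_inj swK)) /=.
rewrite (eq_bigl (fun x : 'I_n * 'I_n => (x.1 < x.2)%N)); last first.
  by move=> x; rewrite -val_eqE /=; case: ltngtP.
by apply: eq_bigr => x lt; rewrite fC // -val_eqE /= gtn_eqF.
Qed.

Lemma adj_pair (n : nat) (K : finType) (w : Omega n K) (p : pairs n) :
  adj w (val p).1 (val p).2 = Some (w p).
Proof. by rewrite /adj -surjective_pairing valK. Qed.

Lemma adjC (n : nat) (K : finType) (w : Omega n K) (i j : 'I_n) :
  adj w i j = adj w j i.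
Proof.
rewrite /adj; case: insubP => [p /= lt _|_]; last by case: insubP.
by rewrite insubN //= -leqNgt ltnW.
Qed.

Lemma in_Theta_sym (R : realType) (n s k : nat) (K : finType)
    (th : array R n K) : in_Theta s k th ->
  forall i j, i != j -> forall l, th i j l = th j i l.
Proof.
case=> z [Q [[uk [us [_ [usC [_ zE]]]]] [_ thQ]]] i j ij l.
by rewrite !thQ // 1?eq_sym // !zE usC.
Qed.

Lemma pair_neq (n : nat) (p : pairs n) : (val p).1 != (val p).2.
Proof. by rewrite -val_eqE ltn_eqF //; case: p. Qed.

Lemma sqdist_pairs (R : realType) (n : nat) (K : finType) (a b : array R n K) :
  (forall i j, i != j -> forall l, a i j l = a j i l) ->
  (forall i j, i != j -> forall l, b i j l = b j i l) ->
  sqdist a b = 2 * \sum_(p : pairs n) \sum_l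
    (a (val p).1 (val p).2 l - b (val p).1 (val p).2 l) ^+ 2.
Proof.
move=> aC bC; rewrite /sqdist.
rewrite (sum_offdiag_sym (f := fun i j => \sum_l (a i j l - b i j l) ^+ 2)) //.
by move=> i j ij; apply: eq_bigr => l _; rewrite aC // bC.
Qed.

(** Over an empty [K] the coordinates of a probability vector would sum to 0. This gives s <= s L,
    so that terms of order s fit into the rate. *)
Lemma in_Theta_card_gt0 (n s k : nat) (K : finType) (R : realType)
    (th : array R n K) : in_Theta s k th -> (0 < s)%N -> (0 < #|K|)%N.
Proof.
case: s => // s [_ [Q [_ [Qp _]]]] _.
rewrite lt0n; apply/negP => /eqP K0.
have [_] := Qp ord0; rewrite big_pred0 => [/eqP|l].
  by rewrite eq_sym oner_eq0.
by have := card0_eq K0 l.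
Qed.

(* A symmetric us has s <= k (k + 1) / 2 values, which together with
   k ^ 2 - s < n and k <= n bounds k ^ 2 linearly in n. *)
Lemma in_Theta_sqr_le (n s k : nat) (K : finType) (R : realType)
    (th : array R n K) :
  in_Theta s k th -> (maxn 0 (k ^ 2 - s) < n)%N -> (k * k <= 3 * n)%N.
Proof.
case=> _ [_ [[uk [us [ukS [usC [usS _]]]]] _]] hn.
have k_le : (k <= n)%N.
  rewrite -(card_ord k) -(card_ord n) -cardsT.
  apply: leq_trans (leq_imset_card uk 'I_n); apply: subset_leq_card.
  by apply/subsetP => a _; have [i <-] := ukS a; rewrite imset_f.
pose lt2 := [set x : 'I_k * 'I_k | (x.1 < x.2)%N].
pose gt2 := [set x : 'I_k * 'I_k | (x.2 < x.1)%N].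
pose diag := [set x : 'I_k * 'I_k | x.1 == x.2].
have cgt : #|gt2| = #|lt2|.
  have swi : injective (fun x : 'I_k * 'I_k => (x.2, x.1)).
    by case=> a b [c d] /= [-> ->].
  rewrite -(card_imset _ swi); apply: eq_card => -[a b]; rewrite !inE /=.
  apply/imsetP/idP => [[[c d]]|ab]; first by rewrite inE /= => lt [-> ->].
  by exists (b, a); rewrite ?inE.
have cdiag : (#|diag| <= k)%N.
  rewrite -[leqRHS]card_ord; apply: (@leq_card_in _ _ fst).
  by move=> [a b] [c d]; rewrite !inE /= => /eqP<- /eqP<- ->.
have cle : (s <= #|lt2| + #|diag|)%N.
  rewrite -(card_ord s) -cardsT.
  apply: leq_trans (leq_of_leqif (leq_card_setU _ _)).
  apply: leq_trans (leq_imset_card (fun x => us x.1 x.2) _).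
  apply: subset_leq_card; apply/subsetP => c _; have [a [b <-]] := usS c.
  have [ab|ba|ab] := ltngtP a b.
  - by apply/imsetP; exists (a, b); rewrite ?inE //= ab.
  - by apply/imsetP; exists (b, a); rewrite ?inE //= ?ba // usC.
  - apply/imsetP; exists (a, b) => //; rewrite !inE; apply/orP; right.
    by rewrite -val_eqE /= ab.
have ctot : (k * k = #|lt2| + #|gt2| + #|diag|)%N.
  rewrite -{1 2}(card_ord k) -card_prod -!sum1_card.
  rewrite [in RHS]big_mkcond [X in (_ + X + _)%N]big_mkcond.
  rewrite [X in (_ + _ + X)%N]big_mkcond -!big_split.
  apply: eq_bigr => x _; rewrite !inE -val_eqE /=.
  by case: ltngtP.
(* With a = #|lt2| and d = #|diag|, k^2 = 2 a + d and s <= a + d give a <= k^2 - s < n, while d <= k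
   <= n. *)
move: hn; rewrite max0n -mulnn; lia.
Qed.

Lemma rate_scaled (R : realType) (n s k L : nat) : (0 < n)%N ->
  n%:R ^+ 2 * rate R n s k L = (s * L)%:R + n%:R * ln (maxn k s)%:R.
Proof. by move=> n0; rewrite /rate; field; rewrite pnatr_eq0 -lt0n. Qed.

(** * Exponential moment of the estimation error *)

Section RiskMoment.
Context (R : realType) (n s k : nat) (K : finType) (th : array R n K).
Hypothesis s_gt0 : (0 < s)%N.
Hypothesis k_gt0 : (0 < k)%N.
Hypothesis n_gt : (maxn 0 (k ^ 2 - s) < n)%N.
Hypothesis th_in : in_Theta s k th.

Let n_gt0 : (0 < n)%N := leq_ltn_trans (leq0n _) n_gt.

Let q (p : pairs n) (l : K) : R := th (val p).1 (val p).2 l.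

Lemma pair_prob_vec (p : pairs n) : prob_vec (q p).
Proof.
have [z [Q [_ [Qp thQ]]]] := th_in; have [Q01 Q1] := Qp (z (val p).1 (val p).2).
split=> [l|]; first by rewrite /q thQ ?pair_neq.
by rewrite -Q1; apply: eq_bigr => l _; rewrite /q thQ ?pair_neq.
Qed.

Lemma pair_prob_ge0 p l : 0 <= q p l.
Proof. by have [/(_ l)/andP[]] := pair_prob_vec p. Qed.

Lemma pair_prob_sum1 p : \sum_l q p l = 1.
Proof. by have [] := pair_prob_vec p. Qed.

Lemma ExpE f : Exp th f = prodE q f. Proof. by []. Qed.

(** The factor 4 comes from n log k plus k^2 log s <= 3 n log s. The remaining 2 exp(s / 8) is
    charged to s L, because the logarithm vanishes when k = s = 1. *)
Lemma shape_count_le_expR_rate :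
  2 * expR (s%:R / 8) * (k ^ n * s ^ (k * k))%:R <=
  expR (4 * (n%:R ^+ 2 * rate R n s k #|K|)).
Proof.
have kk := in_Theta_sqr_le th_in n_gt; have K0 := in_Theta_card_gt0 th_in s_gt0.
have two : 2 <= expR 1 :> R by have := expR_ge1Dx (1 : R); lra.
set M := ln (maxn k s)%:R : R.
have M0 : 0 <= M by apply: ln_ge0; rewrite ler1n leq_max k_gt0.
have kM : ln k%:R <= M.
  by rewrite ler_ln ?posrE ?ltr0n ?leq_max ?k_gt0 // ler_nat leq_maxl.
have sM : ln s%:R <= M.
  by rewrite ler_ln ?posrE ?ltr0n ?leq_max ?k_gt0 // ler_nat leq_maxr.
have s0 : 0 <= ln s%:R :> R by apply: ln_ge0; rewrite ler1n.
rewrite rate_scaled // -/M.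
apply: (@le_trans _ _ (expR 1 * expR (s%:R / 8) *
   (expR (n%:R * ln k%:R) * expR ((k * k)%:R * ln s%:R)))).
  rewrite (expRM_natl n) (expRM_natl (k * k)) !lnK ?posrE ?ltr0n //.
  rewrite natrM !natrX.
  apply: ler_wpM2r; first by rewrite mulr_ge0 ?exprn_ge0.
  by apply: ler_wpM2r => //; exact: expR_ge0.
rewrite -!expRD ler_expR.
have h1 : n%:R * ln k%:R <= n%:R * M by apply: ler_wpM2l.
have h2 : (k * k)%:R * ln s%:R <= 3 * n%:R * M.
  by rewrite ler_pM // -natrM ler_nat.
have h3 : 1 <= (s * #|K|)%:R :> R by rewrite ler1n muln_gt0 s_gt0.
have h4 : s%:R <= (s * #|K|)%:R :> R by rewrite ler_nat leq_pmulr.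
lra.
Qed.

(** 792 = 2 * 396, since [sqdist] counts each unordered pair twice. Shapes are indexed by all pairs
    of maps, a superset with the explicit cardinality k^n s^(k^2). *)
Lemma sqdist_exp_moment (est : Omega n K -> array R n K) : is_LSE s k est ->
  Exp th (fun w => expR (sqdist (est w) th / 792)) <=
  expR (4 * (n%:R ^+ 2 * rate R n s k #|K|)).
Proof.
move=> lse; apply: le_trans shape_count_le_expR_rate.
pose T := ({ffun 'I_n -> 'I_k} * {ffun 'I_k * 'I_k -> 'I_s})%type.
pose g (t : T) (p : pairs n) : 'I_s := t.2 (t.1 (val p).1, t.1 (val p).2).
pose e w (p : pairs n) l := est w (val p).1 (val p).2 l.
have := @least_squares_exp_moment R (pairs n) K 'I_s q pair_prob_ge0
  pair_prob_sum1 T g e.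
rewrite card_ord card_prod !card_ffun card_prod !card_ord.
rewrite [X in _ -> _ -> _ -> _ <= X]mulrC => H.
apply: le_trans (H _ _ _) => //.
- apply: prodE_le => [|w]; first exact: pair_prob_ge0.
  rewrite ler_expR sqdist_pairs;
    [|exact: in_Theta_sym (lse w).1|exact: in_Theta_sym th_in].
  by rewrite /e /q; lra.
- move=> w; have [z [Q [[uk [us [_ [_ [_ zE]]]]] [_ eQ]]]] := (lse w).1.
  exists ([ffun i => uk i], [ffun x => us x.1 x.2]), Q => p l.
  by rewrite /e /g eQ ?pair_neq // zE !ffunE.
(* The true array lies in the class, so it is a competitor of the minimizer. *)
- move=> w; have := (lse w).2 _ th_in.
  rewrite /risk ler_pM2l; last first.
    by rewrite invr_gt0 exprn_gt0 // ltr0n.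
  have XC i j : i != j -> forall l, X R w i j l = X R w j i l.
    by move=> _ l; rewrite /X adjC.
  rewrite !sqdist_pairs //;
    [|exact: in_Theta_sym th_in|exact: in_Theta_sym (lse w).1].
  rewrite ler_pM2l // /noise /e /q /X.
  by under eq_bigr do rewrite adj_pair;
    under [leRHS]eq_bigr do rewrite adj_pair.
Qed.

End RiskMoment.

Theorem theorem1 (R : realType) :
  (forall C' : R, 0 < C' ->
    exists C : R, 0 < C /\
    forall (n s k : nat) (K : finType) (th : array R n K)
      (est : Omega n K -> array R n K),
      (0 < s)%N -> (0 < k)%N -> (maxn 0 (k ^ 2 - s) < n)%N ->
      in_Theta s k th -> is_LSE s k est ->
      1 - expR (- (C' * n%:R * ln s%:R)) <=
        Pr th (fun w => risk (est w) th <= C * rate R n s k #|K|))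
  /\
  (exists C1 : R, 0 < C1 /\
    forall (n s k : nat) (K : finType) (th : array R n K)
      (est : Omega n K -> array R n K),
      (0 < s)%N -> (0 < k)%N -> (maxn 0 (k ^ 2 - s) < n)%N ->
      in_Theta s k th -> is_LSE s k est ->
      Exp th (fun w => risk (est w) th) <= C1 * rate R n s k #|K|).
Proof.
split=> [C' C'0|].
  exists (792 * (4 + C')); split; first by lra.
  move=> n s k K th est s0 k0 n_gt th_in lse.
  have moment := sqdist_exp_moment s0 k0 n_gt th_in lse.
  have q0 := pair_prob_ge0 th_in; have q1 := pair_prob_sum1 th_in.
  have n0 : (0 < n)%N := leq_ltn_trans (leq0n _) n_gt.
  have rateE := rate_scaled R s k #|K| n0.
  set W := n%:R ^+ 2 * _ in moment rateE.
  have n2 : 0 < n%:R ^+ 2 :> R by rewrite exprn_gt0 // ltr0n.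
  pose c := expR (- ((4 + C') * W)).
  (* Markov's inequality: the indicator of the good event dominates 1 - c exp(D / 792), D the
     squared error. The mean of the subtracted term is at most exp(- C' W), and W >= n log s. *)
  apply: (@le_trans _ _ (Exp th (fun w =>
      1 + - c * expR (sqdist (est w) th / 792)))).
    rewrite ExpE prodE_add prodE_cst // prodE_mulr mulNr lerD2l lerN2.
    apply: (le_trans (ler_wpM2l (expR_ge0 _) moment)).
    rewrite -expRD ler_expR rateE.
    have h1 : 0 <= (s * #|K|)%:R :> R by [].
    have sM : ln s%:R <= ln (maxn k s)%:R :> R.
      by rewrite ler_ln ?posrE ?ltr0n ?leq_max ?k0 // ler_nat leq_maxr.
    have := ler_wpM2l (mulr_ge0 (ltW C'0) (ler0n R n)) sM.
    have := mulr_ge0 (ltW C'0) h1; lra.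
  rewrite /Exp /Pr [leRHS]big_mkcond /=; apply: ler_sum => w _.
  have w0 : 0 <= weight th w by apply: prodr_ge0.
  case: ifPn => [_|].
    rewrite ler_piMr // gerDl mulNr oppr_le0 mulr_ge0 ?expR_ge0 //.
  rewrite -ltNge /risk ltr_pdivlMl // => bad.
  rewrite mulr_ge0_le0 // mulNr subr_le0 -expRD -[leLHS]expR0 ler_expR.
  rewrite /W; lra.
exists (792 * 4); split; first by lra.
move=> n s k K th est s0 k0 n_gt th_in lse.
have moment := sqdist_exp_moment s0 k0 n_gt th_in lse.
have q0 := pair_prob_ge0 th_in; have q1 := pair_prob_sum1 th_in.
have n0 : (0 < n)%N := leq_ltn_trans (leq0n _) n_gt.
set W := n%:R ^+ 2 * _ in moment.
have n2 : 0 < n%:R ^+ 2 :> R by rewrite exprn_gt0 // ltr0n.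
rewrite ExpE prodE_mulr ler_pdivrMl //.
(* The tangent of the exponential at 4 W bounds the squared error linearly by its exponential, an
   explicit Jensen inequality. Integrating the tail bound would fail for s = 1, where it is
   trivial. *)
pose c := expR (- (4 * W)).
apply: (@le_trans _ _ (Exp th (fun w =>
    792 * (4 * W - 1 + c * expR (sqdist (est w) th / 792))))).
  apply: prodE_le => // w; rewrite -expRD.
  by have := expR_ge1Dx (- (4 * W) + sqdist (est w) th / 792); lra.
rewrite ExpE prodE_mulr prodE_add prodE_cst // prodE_mulr.
have : c * expR (4 * W) = 1 by rewrite -expRD addNr expR0.
have := ler_wpM2l (expR_ge0 (- (4 * W))) moment; rewrite -/c ExpE /W; lra.
Qed.
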